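(* For every $n\ge 3$ and every $j\in\{1,\dots,m\}$, the function $f_{n,j}$ is a contraction on $\left[\frac{1}{3(n+1)},\frac13\right]$, and $\alpha_{n,j}$ is the unique solution $\alpha$ of the equation $$\alpha=f_{n,j}(\alpha).$$
   Context: $a(t)=t^{-1}+t^2$, and $T_n(a)$ is the $n\times n$ Toeplitz matrix whose $(j,k)$ entry is $1$ if $k=j+1$ or $k=j-2$, and $0$ otherwise. For $n\ge3$ write $n=3m+r$ with $m\in\mathbb{N}$, $r\in\{0,1,2\}$. $L=3/\sqrt[3]{4}$. $T_n(a)$ has exactly $m$ eigenvalues in $(0,L)$, all simple, denoted $0<\lambda_{n,1}<\dots<\lambda_{n,m}<L$. Define $F\colon[0,L]\to[0,1/3]$ by $F(0)=0$ and $F(\lambda)=\frac13-\frac1\pi\arctan\left(\sqrt3\tanh\left(\frac13\operatorname{arcosh}((L/\lambda)^{3/2})\right)\right)$ for $0<\lambda\le L$; it is a continuous strictly increasing bijection. Put $\alpha_{n,j}=F(\lambda_{n,j})$. On $[0,1/3]$ define $$\vartheta(\alpha)=\frac16-\frac\alpha2-\frac1\pi\arctan\frac{\tan(\frac\pi3-\pi\alpha)}{3},\quad p(\alpha)=\frac{\tan(\frac\pi3-\pi\alpha)}{\sqrt{9+\tan^2(\frac\pi3-\pi\alpha)}},\quad q(\alpha)=\frac{1}{2\cos(\frac\pi3-\pi\alpha)}.$$ For $j\in\{1,\dots,m\}$ let $\sigma_{n,j}=\dfrac{j-\frac12+\frac r3}{n+\frac32}$ and define $f_{n,j}\colon[0,1/3]\to[0,1/3]$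 by $$f_{n,j}(\alpha)=\sigma_{n,j}-\frac{\vartheta(\alpha)}{n+\frac32}+\frac{(-1)^{r+j+1}}{(n+\frac32)\pi}\arcsin\big(p(\alpha)q(\alpha)^{n+1}\big).$$ A function is a contraction on an interval $I$ if it maps $I$ into $I$ and is Lipschitz on $I$ with some coefficient strictly less than $1$. *)

(* Defs.v *)
From mathcomp Require Import all_boot all_order all_algebra.
From mathcomp Require Import all_classical all_reals all_analysis.
From mathcomp Require polyrcf.

Set Implicit Arguments.
Unset Strict Implicit.
Unset Printing Implicit Defensive.

Import Order.TTheory GRing.Theory Num.Theory.
Import numFieldNormedType.Exports.

Local Open Scope ring_scope.
Local Open Scope classical_set_scope.

Section Defs.
Variable R : realType.

Definition tanh (x : R) : R :=
  (expR x - expR (- x)) / (expR x + expR (- x)).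

(* meant for 1 <= x *)
Definition arcosh (x : R) : R := ln (x + Num.sqrt (x ^+ 2 - 1)).

(* T_n(a) for a(t) = t^-1 + t^2.  Indices start at 0 here; the entries depend
   only on the difference of the indices, so the shift is immaterial. *)
Definition toeplitz (n : nat) : 'M[R]_n :=
  \matrix_(j < n, k < n) ((k == j.+1 :> nat) || (j == k.+2 :> nat))%:R.

Definition L : R := 3 / (4 `^ 3^-1).

(* The distinct eigenvalues of T_n(a) in the open interval (0, L), in
   increasing order: [polyrcf.roots p a b] is the increasing list of the roots
   of [p] in ]a, b[.  See [mem_eigenvalues] and [sorted_eigenvalues]. *)
Definition eigenvalues (n : nat) : seq R :=
  polyrcf.roots (char_poly (toeplitz n)) 0 L.

Lemma mem_eigenvalues n x :
  (x \in eigenvalues n) = eigenvalue (toeplitz n) x && (0 < x < L).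
Proof.
rewrite /eigenvalues polyrcf.in_roots eigenvalue_root_char in_itv /=.
by rewrite monic_neq0 ?char_poly_monic// andbT.
Qed.

Lemma sorted_eigenvalues n : sorted <%R (eigenvalues n).
Proof. exact: polyrcf.sorted_roots. Qed.

(* lambda_{n,j}, with j counted from 1.  The default value 0 of [nth] is not an
   element of (0, L); it is returned only if T_n(a) has fewer than j
   eigenvalues in (0, L). *)
Definition lambda (n j : nat) : R := nth 0 (eigenvalues n) j.-1.

Definition F (x : R) : R :=
  if x == 0 then 0 else
  1 / 3 - 1 / pi *
    atan (Num.sqrt 3 * tanh (1 / 3 * arcosh ((L / x) `^ (3 / 2)))).

Definition alpha (n j : nat) : R := F (lambda n j).

Definition vartheta (a : R) : R :=
  1 / 6 - a / 2 - 1 / pi * atan (tan (pi / 3 - pi * a) / 3).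

Definition p (a : R) : R :=
  tan (pi / 3 - pi * a) / Num.sqrt (9 + tan (pi / 3 - pi * a) ^+ 2).

Definition q (a : R) : R := 1 / (2 * cos (pi / 3 - pi * a)).

(* In [sigma] and [f], n = 3 m + r with m = n %/ 3 and r = n %% 3. *)
Definition sigma (n j : nat) : R :=
  (j%:R - 1 / 2 + (n %% 3)%:R / 3) / (n%:R + 3 / 2).

Definition f (n j : nat) (a : R) : R :=
  sigma n j - vartheta a / (n%:R + 3 / 2)
  + (-1) ^+ (n %% 3 + j + 1) / ((n%:R + 3 / 2) * pi)
    * asin (p a * q a ^+ n.+1).

(* The library's [is_contraction] is about bundled maps {fun I >-> I}; this is
   the same notion for a plain function. *)
Definition contraction_on (I : set R) (g : R -> R) : Prop :=
  set_fun I I g /\ exists k : R, 0 <= k < 1 /\ k.-lipschitz_I g.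

End Defs.

Arguments L {R}.
Arguments f R n j a : clear implicits.

(* Main.v *)
(** Put [x = pi / 3 - pi * alpha], a decreasing parametrization of [0, L] by
    [0, pi / 3] through [lam]. Solving the three-term recurrence satisfied by the
    eigenvectors shows that [lam x] is an eigenvalue of T_n(a) iff
    [sin ((n + 1) x + eta x) = (-1)^(n+1) sin (amp x)], where
    [sin (eta x) = p alpha] and [sin (amp x) = p alpha * q alpha ^ (n+1)], i.e. iff
    [(n + 1) x + eta x + (-1)^(n+k) amp x = pi k] for some [k]. For
    [k = m + 1 - j] this is the equation [alpha = f_{n,j} alpha].
    Since [0 <= amp' <= q^(n+1) (n + 1 + eta')] with [q <= 1], the left-hand side
    is strictly increasing on [0, pi / 3]; hence each [k] in 1..m has exactly one
    root, and no other [k] has one in the open interval. Near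
    [alpha = 0], where [q = 1], [f_{n,j}] need not be a contraction; but for
    [alpha >= 1 / (3 (n + 1))] one has [q^(n+1) <= 3 / 5], whence the Lipschitz
    constant 4 / 5. *)

Require Import Defs.
From mathcomp Require Import all_boot all_order all_algebra.
From mathcomp Require Import all_classical all_reals all_analysis.
From mathcomp Require Import ring lra zify.

Set Implicit Arguments.
Unset Strict Implicit.
Unset Printing Implicit Defensive.

Import Order.TTheory GRing.Theory Num.Theory.
Import numFieldNormedType.Exports.
Local Open Scope ring_scope.
Local Open Scope classical_set_scope.

(** * Eigenvalues of the Toeplitz matrix through a scalar recurrence *)

Section ToeplitzSpectrum.
Variable R : realType.

(** Vanishing of [w] beyond [n] absorbs the case where [a] is out of range, so boundary columns of
    the matrix need no separate treatment. *)
Lemma sum_nat_delta (n a : nat) (w : nat -> R) :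
  (forall j, (n <= j)%N -> w j = 0) ->
  \sum_(j < n) w j * (j == a :> nat)%:R = w a.
Proof.
move=> w0; have [an|na] := ltnP a n.
  rewrite (bigD1 (Ordinal an)) //= eqxx mulr1 big1 ?addr0// => i.
  by rewrite -val_eqE /= => /negPf ->; rewrite mulr0.
rewrite w0// big1// => i _.
have /negPf -> : (i != a :> nat) by have := ltn_ord i; lia.
by rewrite mulr0.
Qed.

Lemma mul_row_toeplitz (n : nat) (w : nat -> R) (k : 'I_n) :
  (forall j, (n <= j)%N -> w j = 0) ->
  ((\row_j w j) *m toeplitz R n) 0 k
  = (if (k : nat) is k'.+1 then w k' else 0) + w k.+2.
Proof.
move=> w0; rewrite !mxE.
rewrite (eq_bigr (fun j : 'I_n => w j * (k == j.+1 :> nat)%:R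
                     + w j * (j == k.+2 :> nat)%:R)); last first.
  move=> j _; rewrite !mxE -mulrDr -natrD; congr (_ * _%:R).
  by case: eqP; case: eqP => //=; lia.
rewrite big_split /= sum_nat_delta//; congr (_ + _).
case: (k : nat) => [|k']; first by rewrite big1// => i _; rewrite mulr0.
by rewrite -(@sum_nat_delta n)//; apply: eq_bigr => i _; rewrite eqSS eq_sym.
Qed.

(* Read from its last entry backwards, a left eigenvector obeys the recurrence
   of [E], with the same two initial zeros; its first column equation forces
   the next term of the recurrence to vanish. *)
Lemma eigenvalue_toeplitz (n : nat) (l : R) (E : nat -> R) :
  E 0%N = 0 -> E 1%N = 0 -> E 2%N != 0 ->
  (forall i, E i.+3 = l * E i.+2 - E i) ->
  eigenvalue (toeplitz R n.+1) l = (E n.+3 == 0).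
Proof.
move=> E0 E1 E2 Er; apply/eigenvalueP/eqP => [[v vT v0]|En].
  (* Extending [v] by zero to all natural indices gives every column equation except the first the
     same three-term shape. *)
  pose w j := if insub j is Some i then v 0 (i : 'I_n.+1) else 0.
  have w0 j : (n.+1 <= j)%N -> w j = 0 by move=> nj; rewrite /w insubF//; lia.
  have vw : v = \row_j w j.
    by apply/rowP => i; rewrite !mxE /w insubT //= => ltn; congr (v _ _); exact: val_inj.
  have eqw k : (k < n.+1)%N ->
      (if k is k'.+1 then w k' else 0) + w k.+2 = l * w k.
    move=> kn; have := mul_row_toeplitz (Ordinal kn) w0.
    by rewrite -vw vT => /= <-; rewrite mxE vw mxE.
  have wE i : (i <= n.+2)%N -> w (n.+2 - i)%N * E 2%N = w n * E i.
    elim/ltn_ind: i => -[|[|[|i]]] IH ile.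
    - by rewrite E0 w0 ?mul0r ?mulr0//; lia.
    - by rewrite E1 w0 ?mul0r ?mulr0//; lia.
    - by rewrite subSS subSS subn0.
    have kn : (n - i < n.+1)%N by lia.
    have := eqw _ kn; have -> : (n - i = (n - i.+1).+1)%N by lia.
    have := IH i.+2 ltac:(lia) ltac:(lia); have := IH i ltac:(lia) ltac:(lia).
    have -> : (n.+2 - i.+2 = (n - i.+1).+1)%N by lia.
    have -> : (n.+2 - i = (n - i.+1).+3)%N by lia.
    have -> : (n.+2 - i.+3 = (n - i.+1))%N by lia.
    move=> H2 H1 H3.
    have -> : w (n - i.+1)%N = l * w (n - i.+1).+1 - w (n - i.+1).+3.
      by rewrite -H3; ring.
    by rewrite Er mulrBl -mulrA H1 H2; ring.
  (* By [wE], every entry is a multiple of the last one, so [w n = 0] would force [v = 0]. *)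
  have wn0 : w n != 0.
    apply: contra v0 => /eqP wn0; apply/eqP/rowP => i; rewrite vw !mxE.
    have := wE (n.+2 - i)%N; rewrite wn0 mul0r subKn; last by have := ltn_ord i; lia.
    by move=> /(_ (leq_subr _ _))/eqP; rewrite mulf_eq0 (negPf E2) orbF => /eqP.
  have := eqw 0%N isT; rewrite add0r => w2.
  have := wE n.+2 (leqnn _); rewrite subnn => e0.
  have := wE n; have -> : (n.+2 - n = 2)%N by lia.
  move=> /(_ ltac:(lia)) e2; apply: (mulfI wn0).
  by rewrite Er mulr0 mulrBr -e2 w2 mulrCA -e0; ring.
pose w j := E (n.+2 - j)%N.
have w0 j : (n.+1 <= j)%N -> w j = 0.
  move=> nj; rewrite /w; have [->//|->//] : (n.+2 - j = 0 \/ n.+2 - j = 1)%N by lia.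
exists (\row_j w j); last first.
  apply/eqP => /rowP/(_ ord_max); rewrite !mxE /w /= => /eqP.
  by rewrite subSn// subSn// subnn (negPf E2).
apply/rowP => k; rewrite mul_row_toeplitz// !mxE /w.
have := ltn_ord k; case: (k : nat) => [|k'] kn.
  by rewrite add0r; move: En; rewrite Er subn0 subSS subSS subn0 => /eqP; rewrite subr_eq0 => /eqP.
have -> : (n.+2 - k' = (n.+2 - k'.+3).+3)%N by lia.
have -> : (n.+2 - k'.+1 = (n.+2 - k'.+3).+2)%N by lia.
by rewrite Er; ring.
Qed.

End ToeplitzSpectrum.

(** * The characteristic equation in trigonometric form *)

Section CharacteristicEquation.
Variable R : realType.
Implicit Types x : R.

Definition eta x : R := atan (tan x / 3).

Definition lamroot x : R := (2 * cos x) `^ 3^-1.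

(* For [x] in ]0, pi / 3[ the roots of [z ^ 3 - lam x * z ^ 2 + 1] are
   [lamroot x * expi (x)], its conjugate, and [- (lamroot x) ^ -2]. *)
Definition lam x : R := lamroot x ^+ 4 - lamroot x ^- 2.

(* [fun i => lamroot x ^+ i * charseq x i] is the [E] of [eigenvalue_toeplitz]
   for [l = lam x]. *)
Definition charseq x (i : nat) : R :=
  (2 * cos x ^+ 2 + 1) * sin (i%:R * x) - 2 * sin x * cos x * cos (i%:R * x)
  + 2 * sin x * cos x * (- (2 * cos x)^-1) ^+ i.

Lemma lamroot_gt0 x : 0 < cos x -> 0 < lamroot x.
Proof. by move=> c0; rewrite powR_gt0// mulr_gt0. Qed.

Lemma lamroot3 x : 0 < cos x -> lamroot x ^+ 3 = 2 * cos x.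
Proof.
move=> c0; have c20 : 0 <= 2 * cos x by rewrite mulr_ge0// ltW.
by rewrite -powR_mulrn ?powR_ge0// -powRrM mulVf// powRr1.
Qed.

(** With [c = cos x], the characteristic polynomial [2 c z^3 - (4 c^2 - 1) z^2 + 1] factors as
    [(z^2 - 2 c z + 1) (2 c z + 1)]. Its roots are [expi x], its conjugate and [- (2 c)^-1], whose
    powers make up [charseq]. *)
Lemma charseqS3 x i : cos x != 0 ->
  2 * cos x * charseq x i.+3
  = (4 * cos x ^+ 2 - 1) * charseq x i.+2 - charseq x i.
Proof.
move=> c0.
have trigS j : (sin (j.+1%:R * x) = sin (j%:R * x) * cos x + cos (j%:R * x) * sin x) *
               (cos (j.+1%:R * x) = cos (j%:R * x) * cos x - sin (j%:R * x) * sin x).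
  by rewrite -natr1 mulrDl mul1r sinD cosD.
have sinSS j : sin (j.+2%:R * x) = 2 * cos x * sin (j.+1%:R * x) - sin (j%:R * x).
  rewrite !trigS mulrBl mulrDl -!mulrA -!expr2 sin2cos2; ring.
have cosSS j : cos (j.+2%:R * x) = 2 * cos x * cos (j.+1%:R * x) - cos (j%:R * x).
  rewrite !trigS mulrBl mulrDl -!mulrA -!expr2 sin2cos2; ring.
by rewrite /charseq !sinSS !cosSS !exprS; field.
Qed.

(** Since [lam x = lamroot x ^- 2 * (4 * cos x ^+ 2 - 1)] and [lamroot x ^+ 3 = 2 * cos x], scaling
    by [lamroot x ^+ i] turns the recurrence of [charseqS3] into the one for eigenvectors.
    Positivity of [sin x] keeps the term of index 2 nonzero. *)
Lemma eigenvalue_charseq x n : 0 < cos x -> 0 < sin x ->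
  eigenvalue (toeplitz R n.+1) (lam x) = (charseq x n.+3 == 0).
Proof.
move=> c0 s0; have r0 := lamroot_gt0 c0; have r3 := lamroot3 c0.
have cn0 := lt0r_neq0 c0; have rn0 := lt0r_neq0 r0.
rewrite (@eigenvalue_toeplitz R n _ (fun i => lamroot x ^+ i * charseq x i)).
- by rewrite mulf_eq0 expf_eq0 (negPf rn0) andbF.
- by rewrite expr0 mul1r /charseq !mul0r sin0 cos0 expr0; ring.
- rewrite /charseq !mul1r (_ : 2 * cos x ^+ 2 + 1 = 1 + 2 * cos x * cos x); last by ring.
  by rewrite expr1; field.
- rewrite mulf_neq0 ?expf_neq0// /charseq [2%:R * x]mulr_natl sin_mulr2n cos_mulr2n.
  have -> : (2 * cos x ^+ 2 + 1) * (cos x * sin x *+ 2) -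
     2 * sin x * cos x * (cos x ^+ 2 *+ 2 - 1) +
     2 * sin x * cos x * (- (2 * cos x)^-1) ^+ 2
     = 2 * (sin x * cos x * (2 + (2 * cos x) ^- 2)) by field.
  by rewrite !mulf_neq0 ?(gt_eqF s0)// gt_eqF// addr_gt0// invr_gt0 exprn_gt0// mulr_gt0.
move=> i; apply: (mulfI (x := lamroot x ^+ 3)); first exact: expf_neq0.
have -> : lamroot x ^+ 3 * (lamroot x ^+ i.+3 * charseq x i.+3)
   = lamroot x ^+ i.+3 * (2 * cos x * charseq x i.+3) by rewrite -r3; ring.
rewrite charseqS3// (_ : lam x = lamroot x ^- 2 * (4 * cos x ^+ 2 - 1)).
  by rewrite !exprS expr0; field.
rewrite /lam (_ : 4 * cos x ^+ 2 = (lamroot x ^+ 3) ^+ 2); last by rewrite r3; ring.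
by field.
Qed.

(** The oscillating terms reduce to [3 * cos x * S + sin x * K], and [tan (eta x) = tan x / 3]
    merges them into one sine shifted by [eta x]. *)
Lemma charseqE x n : 0 < cos x ->
  charseq x n.+2 = 3 * cos x / cos (eta x) *
    (sin (n.+1%:R * x + eta x)
     + (-1) ^+ n * (sin (eta x) * (2 * cos x)^-1 ^+ n.+1)).
Proof.
move=> c0; have cn0 := lt0r_neq0 c0.
have e0 : cos (eta x) != 0.
  by rewrite gt_eqF// cos_gt0_pihalf// atan_gtNpi2 atan_ltpi2.
have e : sin (eta x) = cos (eta x) * sin x / cos x / 3.
  have := atanK (tan x / 3); rewrite -/(eta x) /tan => /(canRL (divfK e0)) ->.
  by field.
rewrite /charseq (_ : n.+2%:R * x = n.+1%:R * x + x); last first.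
  by rewrite -[n.+2]addn1 natrD mulrDl mul1r.
set S := sin (n.+1%:R * x); set K := cos (n.+1%:R * x).
rewrite !sinD cosD -/S -/K e.
have -> : (2 * cos x ^+ 2 + 1) * (S * cos x + K * sin x)
    - 2 * sin x * cos x * (K * cos x - S * sin x) = 3 * cos x * S + sin x * K.
  transitivity (S * cos x * (2 * (cos x ^+ 2 + sin x ^+ 2) + 1) + sin x * K).
    by ring.
  by rewrite cos2Dsin2; ring.
rewrite !exprS [(- (2 * cos x)^-1) ^+ n]exprNn !exprVn.
by field; rewrite cn0 e0 expf_neq0 ?mulf_neq0.
Qed.

End CharacteristicEquation.

(** * The phase function: derivatives, bounds and monotonicity *)

Section PhaseFunction.
Variable R : realType.
Implicit Types x y : R.

Definition deta x : R := (cos x) ^- 2 / 3 / (1 + (tan x / 3) ^+ 2).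

Definition amp (N : nat) x : R := asin (sin (eta x) * (2 * cos x)^-1 ^+ N).

Definition damp (N : nat) x : R :=
  (2 * cos x)^-1 ^+ N * (cos (eta x) * deta x + N%:R * sin (eta x) * tan x)
  / Num.sqrt (1 - (sin (eta x) * (2 * cos x)^-1 ^+ N) ^+ 2).

Definition phase (N : nat) (s : R) x : R := N%:R * x + eta x + s * amp N x.

Lemma cos_pithird : cos (pi / 3) = 2^-1 :> R.
Proof.
have pi0 := @pi_gt0 R.
have c0 : 0 < cos (pi / 3 : R) by apply: cos_gt0_pihalf; apply/andP; split; lra.
(* The triple-angle formula for [cos pi = -1] gives [(c + 1) (2 c - 1)^2 = 0] with [c > 0]. *)
have e : pi / 3 *+ 2 + pi / 3 = pi :> R by field.
have := cospi R; rewrite -{1}e.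
rewrite cosD cos_mulr2n sin_mulr2n; move: (sin2cos2 (pi / 3 : R)).
move: (cos (pi / 3)) (sin (pi / 3)) c0 => c s c0 s2 /eqP.
rewrite mulrnAl -mulrA -expr2 s2 -subr_eq0.
have -> : (c ^+ 2 *+ 2 - 1) * c - (c * (1 - c ^+ 2)) *+ 2 - -1
          = (c + 1) * (2 * c - 1) ^+ 2 by ring.
rewrite mulf_eq0 expf_eq0 /= => /orP[|] /eqP h.
  by lra.
by lra.
Qed.

Lemma sin_pisixth : sin (pi / 6) = 2^-1 :> R.
Proof.
by rewrite -cos_pithird -cosBpihalf -cosN; congr cos; field.
Qed.

Section Pointwise.
Variable x : R.
Hypothesis x_itv : 0 <= x <= pi / 3.

Lemma cos_ge_half : 2^-1 <= cos x.
Proof.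
have pi0 := @pi_gt0 R; have [x0] := andP x_itv.
rewrite le_eqVlt => /predU1P[->|xlt].
  by rewrite cos_pithird.
by rewrite -cos_pithird; apply/ltW; rewrite ltr_cos// ?in_itv /=; apply/andP; split; lra.
Qed.

Lemma cos_gt0_third : 0 < cos x.
Proof. by have := cos_ge_half; lra. Qed.

Lemma sin_ge0_third : 0 <= sin x.
Proof. have pi0 := @pi_gt0 R; have [x0 x1] := andP x_itv.
by apply: sin_ge0_pi; apply/andP; split; lra. Qed.

Lemma tan_ge0_third : 0 <= tan x.
Proof. by rewrite divr_ge0 ?sin_ge0_third// ltW// cos_gt0_third. Qed.

Lemma tan_sqr_le3 : tan x ^+ 2 <= 3.
Proof.
have c0 := cos_gt0_third; have := cos2_tan2 (lt0r_neq0 c0).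
suff : (cos x) ^- 2 <= 4 by lra.
rewrite -[4]invrK lef_pV2 ?posrE ?exprn_gt0 ?invr_gt0//.
by have := cos_ge_half; nra.
Qed.

Lemma cos_eta_gt0 : 0 < cos (eta x).
Proof. by rewrite cos_gt0_pihalf// atan_gtNpi2 atan_ltpi2. Qed.

Lemma sin_etaE : sin (eta x) = tan x / 3 * cos (eta x).
Proof. by rewrite -(atanK (tan x / 3)) -/(eta x) divfK// lt0r_neq0// cos_eta_gt0. Qed.

Lemma cos_eta_sqr : cos (eta x) ^+ 2 = (1 + (tan x / 3) ^+ 2)^-1.
Proof.
have := cos2_tan2 (lt0r_neq0 cos_eta_gt0); rewrite /eta atanK => <-.
by rewrite invrK.
Qed.

Lemma sin_eta_ge0 : 0 <= sin (eta x).
Proof.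
rewrite sin_etaE mulr_ge0 ?(ltW cos_eta_gt0)//.
by rewrite divr_ge0 ?tan_ge0_third.
Qed.

(** From [tan x ^+ 2 <= 3] one gets [cos (eta x) ^+ 2 >= 3 / 4]. This keeps the argument of [asin]
    in [amp] away from 1, where [asin] is not differentiable. *)
Lemma sin_eta_le_half : sin (eta x) <= 2^-1.
Proof.
have h : sin (eta x) ^+ 2 <= 4^-1.
  rewrite sin2cos2 cos_eta_sqr.
  suff : 3 / 4 <= (1 + (tan x / 3) ^+ 2)^-1 by lra.
  rewrite -[3 / 4]invrK lef_pV2 ?posrE ?invr_gt0//.
    have -> : (3 / 4)^-1 = 4 / 3 :> R by field.
    have -> : (tan x / 3) ^+ 2 = tan x ^+ 2 / 9 by field.
    by have := tan_sqr_le3; lra.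
  by have := sqr_ge0 (tan x / 3); lra.
by have := sin_eta_ge0; nra.
Qed.

Lemma eta_ge0 : 0 <= eta x.
Proof. by rewrite -atan0 le_atan// divr_ge0 ?tan_ge0_third. Qed.

Lemma eta_le_pisixth : eta x <= pi / 6.
Proof.
have pi0 := @pi_gt0 R; rewrite leNgt; apply/negP => lt.
have := sin_eta_le_half; rewrite leNgt -sin_pisixth ltr_sin ?lt// in_itv /=.
  by apply/andP; split; lra.
by rewrite !ltW ?atan_gtNpi2 ?atan_ltpi2.
Qed.

Lemma invcos_gt0 : 0 < (2 * cos x)^-1.
Proof. by rewrite invr_gt0 mulr_gt0// cos_gt0_third. Qed.

Lemma invcos_le1 : (2 * cos x)^-1 <= 1.
Proof.
rewrite -invr1 lef_pV2 ?posrE// ?mulr_gt0// ?cos_gt0_third//.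
by have := cos_ge_half; lra.
Qed.

Lemma invcosX_le1 N : 0 < (2 * cos x)^-1 ^+ N <= 1.
Proof. by rewrite exprn_gt0 ?invcos_gt0// exprn_ile1 ?invcos_le1 ?(ltW invcos_gt0). Qed.

Lemma amp_arg_ge0 N : 0 <= sin (eta x) * (2 * cos x)^-1 ^+ N.
Proof. by rewrite mulr_ge0 ?sin_eta_ge0// ltW//; case/andP: (invcosX_le1 N). Qed.

Lemma amp_arg_le N : sin (eta x) * (2 * cos x)^-1 ^+ N <= sin (eta x).
Proof. by rewrite ler_piMr ?sin_eta_ge0//; case/andP: (invcosX_le1 N). Qed.

Lemma sin_amp N : sin (amp N x) = sin (eta x) * (2 * cos x)^-1 ^+ N.
Proof.
rewrite asinK// in_itv /=; have := amp_arg_ge0 N; have := amp_arg_le N.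
by have := sin_eta_le_half; move=> *; apply/andP; split; lra.
Qed.

Lemma amp_itv N : amp N x \in `[- (pi / 2), pi / 2]%R.
Proof.
have := amp_arg_ge0 N; have := amp_arg_le N; have := sin_eta_le_half => h1 h2 h3.
by rewrite in_itv /= asin_geNpi2 ?asin_lepi2//; apply/andP; split; lra.
Qed.

Lemma amp_ge0 N : 0 <= amp N x.
Proof.
have pi0 := @pi_gt0 R; rewrite leNgt; apply/negP => lt.
have := amp_arg_ge0 N; rewrite -sin_amp -[X in X <= _]sin0 leNgt ltr_sin ?lt//.
  exact: amp_itv.
by rewrite in_itv /=; apply/andP; split; lra.
Qed.

Lemma amp_le_eta N : amp N x <= eta x.
Proof.
have pi0 := @pi_gt0 R; rewrite leNgt; apply/negP => lt.
have := amp_arg_le N; rewrite -sin_amp leNgt ltr_sin ?lt// ?amp_itv//.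
have := eta_ge0; have := eta_le_pisixth => e1 e2.
by rewrite in_itv /=; apply/andP; split; lra.
Qed.

Lemma is_derive_eta : is_derive x 1 (@eta R) (deta x).
Proof.
have c0 := lt0r_neq0 cos_gt0_third.
have dt := is_derive_tan c0.
have d3 : is_derive x 1 (fun y => tan y / 3) ((cos x) ^- 2 / 3).
  have -> : (fun y => tan y / 3) = 3^-1 \*: (@tan R).
    by apply/funext => y; rewrite /GRing.scale /= mulrC.
  by apply: is_derive_eq; rewrite /GRing.scale /= mulrC.
have := @is_derive1_comp R atan (fun y => tan y / 3) _ _ _ (is_derive1_atan _) d3.
by move=> h; apply: is_derive_eq; rewrite mulrC.
Qed.

Lemma is_derive_amp N : is_derive x 1 (@amp N) (damp N x).
Proof.
have c0 := lt0r_neq0 cos_gt0_third.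
have dsin : is_derive x 1 (fun y => sin (eta y)) (cos (eta x) * deta x).
  exact: (@is_derive1_comp R sin (@eta R) _ _ _ (is_derive_sin _) is_derive_eta).
have dq : is_derive x 1 (fun y : R => (2 * cos y)^-1) ((2 * cos x)^-1 * tan x).
  have d2 : is_derive x 1 (2 \*: (@cos R)) (2 *: - sin x).
    exact: is_deriveZ.
  have := @is_deriveV _ _ _ _ _ _ d2; rewrite /= => h.
  apply: is_derive_eq (h _) _; first by rewrite /GRing.scale /= mulf_neq0.
  by rewrite /GRing.scale /= /tan; field.
have dqN := @is_deriveX _ _ _ N _ _ _ dq.
have dM := is_deriveM dsin dqN; rewrite exprfctE in dM.
have arg1 : -1 < sin (eta x) * (2 * cos x)^-1 ^+ N < 1.
  have := amp_arg_ge0 N; have := amp_arg_le N.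
  by have := sin_eta_le_half => *; apply/andP; split; lra.
have h := @is_derive1_comp R asin
  (fun y => sin (eta y) * (2 * cos y)^-1 ^+ N) _ _ _ (is_derive1_asin arg1) dM.
apply: is_derive_eq => {arg1 h dM dqN}.
rewrite /GRing.scale /= /damp [RHS]mulrC; congr (_ * _).
case: N => [|N]; first by rewrite !expr0 mul0r; ring.
by rewrite !exprS /=; ring.
Qed.

Lemma detaE : deta x = 3 * (1 + tan x ^+ 2) / (9 + tan x ^+ 2).
Proof.
rewrite /deta cos2_tan2 ?lt0r_neq0 ?cos_gt0_third//; field.
by have := sqr_ge0 (tan x) => ?; rewrite !lt0r_neq0//; lra.
Qed.

Lemma deta_ge : 3^-1 <= deta x.
Proof.
have t2 := sqr_ge0 (tan x); rewrite detaE ler_pdivlMr; lra.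
Qed.

Lemma deta_le1 : deta x <= 1.
Proof.
have t2 := sqr_ge0 (tan x); have := tan_sqr_le3; rewrite detaE ler_pdivrMr; lra.
Qed.

Lemma damp_ge0 N : 0 <= damp N x.
Proof.
rewrite /damp divr_ge0 ?sqrtr_ge0// mulr_ge0//.
  by case/andP: (invcosX_le1 N) => /ltW.
have d0 : 0 <= deta x by have := deta_ge; lra.
have c0 := ltW cos_eta_gt0; have s0 := sin_eta_ge0; have t0 := tan_ge0_third.
apply: addr_ge0; first exact: mulr_ge0.
by apply: mulr_ge0 => //; exact: mulr_ge0.
Qed.

(* The radicand is at least [1 - sin (eta x) ^+ 2 = cos (eta x) ^+ 2], and
   [tan (eta x) * tan x = tan x ^+ 2 / 3 <= 1]. *)
Lemma damp_le N : damp N x <= (2 * cos x)^-1 ^+ N * (N%:R + deta x).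
Proof.
have [u0 u1] := andP (invcosX_le1 N).
have ce := cos_eta_gt0; have a0 := amp_arg_ge0 N; have a1 := amp_arg_le N.
have r1 : cos (eta x) <= Num.sqrt (1 - (sin (eta x) * (2 * cos x)^-1 ^+ N) ^+ 2).
  rewrite -[leLHS](ger0_norm (ltW ce)) -sqrtr_sqr ler_sqrt; last first.
    by have := sin_eta_le_half; nra.
  by rewrite cos2sin2; nra.
rewrite /damp ler_pdivrMr; last exact: lt_le_trans ce r1.
rewrite -[leRHS]mulrA ler_pM2l//; apply: le_trans (ler_wpM2l _ r1); last first.
  by have := deta_ge; have := ler0n R N; lra.
rewrite mulrDl [leRHS]addrC mulrC lerD2l -!mulrA ler_wpM2l// sin_etaE.
by have := tan_sqr_le3; nra.
Qed.

End Pointwise.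


Lemma MVT_third (g dg : R -> R) x y :
  (forall z, 0 <= z <= pi / 3 -> is_derive z 1 g (dg z)) ->
  0 <= x -> x < y -> y <= pi / 3 ->
  exists2 z, x < z < y & g y - g x = dg z * (y - x).
Proof.
move=> gd x0 xy y1.
have zin z : x <= z <= y -> 0 <= z <= pi / 3.
  by move=> /andP[xz zy]; rewrite (le_trans x0 xz) (le_trans zy y1).
have [z|z zxy|z] := @MVT R g dg x y xy; last by exists z.
  rewrite in_itv /= => /andP[xz zy]; apply: gd; apply: zin.
  by rewrite !ltW.
apply: (derivable_within_continuous (i := `[x, y]%R)) => t /= txy.
by have [] := gd t (zin _ txy).
Qed.

Lemma eta_lipschitz x y : 0 <= x -> x <= y -> y <= pi / 3 ->
  0 <= eta y - eta x <= y - x.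
Proof.
move=> x0; rewrite le_eqVlt => /predU1P[->|xy y1]; first by rewrite !subrr lexx.
have [z /andP[xz zy] ->] := MVT_third is_derive_eta x0 xy y1.
have z01 : 0 <= z <= pi / 3 by apply/andP; split; lra.
have := deta_ge z01; have := deta_le1 z01 => d1 d0.
by apply/andP; split; nra.
Qed.

(** The bound of [damp_le] is moved from the intermediate point to the right endpoint, because
    [(2 * cos z)^-1] increases on the interval. *)
Lemma amp_lipschitz N x y : 0 <= x -> x <= y -> y <= pi / 3 ->
  0 <= amp N y - amp N x <= (2 * cos y)^-1 ^+ N * (N%:R + 1) * (y - x).
Proof.
have pi0 := @pi_gt0 R.
move=> x0; rewrite le_eqVlt => /predU1P[->|xy y1].
  by rewrite !subrr mulr0 lexx.
have [z /andP[xz zy] ->] := MVT_third (fun z h => is_derive_amp h N) x0 xy y1.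
have z01 : 0 <= z <= pi / 3 by apply/andP; split; lra.
have y01 : 0 <= y <= pi / 3 by apply/andP; split; lra.
rewrite mulr_ge0 ?damp_ge0//=; last by lra.
rewrite ler_wpM2r//; first by lra.
apply: le_trans (damp_le z01 N) _; have [u0 _] := andP (invcosX_le1 z01 N).
apply: ler_pM; [exact: ltW|by have := deta_ge z01; have := ler0n R N; lra| |].
  rewrite lerXn2r ?nnegrE ?(ltW (invcos_gt0 _))//.
  rewrite lef_pV2 ?posrE ?mulr_gt0 ?cos_gt0_third// ler_pM2l// ltW//.
  by rewrite ltr_cos// in_itv /=; apply/andP; split; lra.
by rewrite lerD2l deta_le1.
Qed.

Lemma is_derive_phase N s x : 0 <= x <= pi / 3 ->
  is_derive x 1 (phase N s) (N%:R + deta x + s * damp N x).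
Proof.
move=> x01; have de := is_derive_eta x01; have da := is_derive_amp x01 N.
have -> : phase N s = (N%:R \*: id) + @eta R + (s \*: amp N) by [].
by apply: is_derive_eq; rewrite /GRing.scale /= mulr1.
Qed.

Lemma phase_lt N s x y : (0 < N)%N -> -1 <= s <= 1 ->
  0 <= x -> x < y -> y <= pi / 3 -> phase N s x < phase N s y.
Proof.
move=> N0 /andP[s0 s1] x0 xy y1; rewrite -subr_gt0.
have [z /andP[xz zy] ->] := MVT_third (is_derive_phase N s) x0 xy y1.
rewrite mulr_gt0 ?subr_gt0//; have pi0 := @pi_gt0 R.
have z01 : 0 <= z <= pi / 3 by apply/andP; split; lra.
(* The intermediate point lies strictly below [pi / 3], so the power is strictly less than 1. This
   makes the derivative positive even for [s = -1]. *)
have u1 : (2 * cos z)^-1 ^+ N < 1.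
  rewrite exprn_ilt1 -?lt0n// ?(ltW (invcos_gt0 z01))//.
  rewrite -invr1 ltf_pV2 ?posrE ?mulr_gt0 ?cos_gt0_third//.
  suff : 2^-1 < cos z by lra.
  by rewrite -cos_pithird ltr_cos ?in_itv /=; [lra|apply/andP; split; lra..].
have := damp_le z01 N; have := damp_ge0 z01 N; have := deta_ge z01.
have : 1 <= N%:R :> R by rewrite ler1n.
move: (N%:R) (deta z) (damp N z) (_ ^+ N) u1 => M d A u u1 M1 d0 A0 Au.
have : A < M + d by nra.
by nra.
Qed.

Lemma phase_inj N s x y : (0 < N)%N -> -1 <= s <= 1 ->
  0 <= x <= pi / 3 -> 0 <= y <= pi / 3 -> phase N s x = phase N s y -> x = y.
Proof.
move=> N0 s1 /andP[x0 x1] /andP[y0 y1] e.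
have [xy|xy|//] := ltgtP x y.
  by have := phase_lt N0 s1 x0 xy y1; rewrite e ltxx.
by have := phase_lt N0 s1 y0 xy x1; rewrite e ltxx.
Qed.

Lemma bernoulli_ineq (h : R) N : 0 <= h -> 1 + N%:R * h <= (1 + h) ^+ N.
Proof.
move=> h0; elim: N => [|N IH]; first by rewrite mul0r addr0 expr0.
by rewrite exprS -natr1; have := ler0n R N; nra.
Qed.

(* With [y0 = pi / 3 - pi / (3 * N) >= pi / 6], the mean value theorem gives
   [2 * cos y0 >= 1 + pi / (3 * N)]; conclude by Bernoulli and [2 <= pi]. *)
Lemma invcosX_le N x : (2 <= N)%N -> 0 <= x <= pi / 3 - pi / (3 * N%:R) ->
  (2 * cos x)^-1 ^+ N <= 3 / 5.
Proof.
move=> N2 /andP[x0 x1]; have pi0 := @pi_gt0 R; have pi2 := @pi_ge2 R.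
have NR : 2 <= N%:R :> R by rewrite ler_nat.
set d := pi / (3 * N%:R) in x1.
have dN : N%:R * d = pi / 3 by rewrite /d; field; lra.
have d0 : 0 < d by nra.
have d6 : d <= pi / 6 by nra.
have [z /andP[xz zy]] := @MVT_third cos (fun z => - sin z) (pi / 3 - d) (pi / 3)
  (fun z _ => is_derive_cos z) ltac:(lra) ltac:(lra) (lexx _).
rewrite cos_pithird => cE.
have sz : 2^-1 < sin z.
  by rewrite -sin_pisixth ltr_sin ?in_itv /=; [lra|apply/andP; split; lra..].
have cx : cos (pi / 3 - d) <= cos x.
  move: x1; rewrite le_eqVlt => /predU1P[->//|x1]; apply: ltW.
  by rewrite ltr_cos ?in_itv /=; [lra|apply/andP; split; lra..].
have c1 : 1 + d <= 2 * cos x by nra.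
have cx0 : 0 < 2 * cos x by lra.
rewrite exprVn -[leRHS]invrK lef_pV2 ?posrE ?exprn_gt0 ?invr_gt0//.
have -> : (3 / 5)^-1 = 5 / 3 :> R by field.
apply: le_trans (_ : (1 + d) ^+ N <= _).
  by apply: le_trans (bernoulli_ineq N (ltW d0)); lra.
by rewrite lerXn2r ?nnegrE//; lra.
Qed.

End PhaseFunction.

(** * The parametrization [lam] of the interval and its inverse through [F] *)

Section SymbolParametrization.
Variable R : realType.
Implicit Types x : R.

Lemma lamroot_sqr4 : lamroot (0 : R) ^+ 2 = 4 `^ 3^-1.
Proof.
rewrite /lamroot cos0 mulr1 -powR_mulrn ?powR_ge0// -powRrM mulrC powRrM.
by rewrite powR_mulrn//; congr (_ `^ _); ring.
Qed.

Lemma lam0 : lam 0 = L :> R.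
Proof.
have r0 : 0 < lamroot (0 : R) by rewrite lamroot_gt0// cos0.
have r3 : lamroot (0 : R) ^+ 3 = 2 by rewrite lamroot3 cos0 ?mulr1.
rewrite /lam /L -lamroot_sqr4; move: (lamroot 0) r0 r3 => r r0 r3.
have rn0 := lt0r_neq0 r0.
apply: (mulIf (x := r ^+ 2)); first exact: expf_neq0.
rewrite mulrBl mulVf ?expf_neq0// divfK ?expf_neq0//.
have -> : r ^+ 4 * r ^+ 2 = (r ^+ 3) ^+ 2 by ring.
by rewrite r3; ring.
Qed.

Lemma lam_pithird : lam (pi / 3) = 0 :> R.
Proof.
by rewrite /lam /lamroot cos_pithird mulfV// powR1 !expr1n invr1 subrr.
Qed.

Lemma lam_lt x y : 0 <= x -> x < y -> y <= pi / 3 -> lam y < lam x.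
Proof.
have pi0 := @pi_gt0 R; move=> x0 xy y1.
have x01 : 0 <= x <= pi / 3 by apply/andP; split; lra.
have y01 : 0 <= y <= pi / 3 by apply/andP; split; lra.
have rx := lamroot_gt0 (cos_gt0_third x01).
have ry := lamroot_gt0 (cos_gt0_third y01).
have r : lamroot y < lamroot x.
  have cx := cos_gt0_third x01; have cy := cos_gt0_third y01.
  apply: gt0_ltr_powR; rewrite ?invr_gt0// ?nnegrE ?mulr_ge0 ?ltW//.
  by rewrite ltr_pM2l// ltr_cos ?in_itv /=; [lra|apply/andP; split; lra..].
rewrite /lam ltrD//; first by rewrite ltrXn2r// ?ltW.
by rewrite ltrN2 ltf_pV2 ?posrE ?exprn_gt0// ltrXn2r// ?ltW.
Qed.

Lemma lam_itv x : 0 < x < pi / 3 -> 0 < lam x < L.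
Proof.
move=> /andP[x0 x1]; rewrite -lam0 -[X in X < lam x]lam_pithird.
by rewrite !lam_lt ?(ltW x0) ?(ltW x1).
Qed.

Lemma lam_surj l : 0 < l < L -> exists2 x : R, 0 < x < pi / 3 & lam x = l.
Proof.
have pi0 := @pi_gt0 R; move=> /andP[l0 l1].
have p3 : 0 <= pi / 3 :> R by lra.
have dl x : 0 <= x <= pi / 3 -> derivable (@lam R) x 1.
  move=> x01; have c0 := cos_gt0_third x01; have r0 := lamroot_gt0 c0.
  have d2 : is_derive x 1 (2 \*: (@cos R)) (2 *: - sin x) by exact: is_deriveZ.
  have c20 : 0 < (2 \*: @cos R) x by rewrite mulr_gt0.
  have [dr _] := @is_derive1_comp R (@powR R ^~ 3^-1) (2 \*: (@cos R)) x _ _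
    (is_derive1_powR _ c20) d2.
  have d4 : derivable (@lamroot R ^+ 4) x 1 by exact: derivableX.
  have d2X : derivable (@lamroot R ^+ 2) x 1 by exact: derivableX.
  apply: derivableB; first by move: d4; rewrite exprfctE.
  by move: d2X; rewrite exprfctE => ?; apply: derivableV; rewrite ?expf_neq0 ?lt0r_neq0.
have [||x] := @IVT R (@lam R) 0 (pi / 3) l p3.
- by apply: (derivable_within_continuous (i := `[0, pi / 3]%R)) => t /=; exact: dl.
- rewrite lam0 lam_pithird ge_min le_max (ltW l0) (ltW l1) /=.
  by rewrite orbT.
rewrite in_itv /= => /andP[x0 x1] xl; exists x => //.
rewrite !lt_neqAle x0 x1 !andbT; apply/andP; split.
  by apply: contraTneq l1 => x0'; rewrite -xl -x0' lam0 ltxx.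
by apply: contraTneq l0 => x1'; rewrite -xl x1' lam_pithird ltxx.
Qed.

(** Cubing removes the cube root hidden in [lamroot], leaving a rational function of [cos x]. *)
Lemma lam_cube x : 0 < cos x ->
  lam x ^+ 3 = (4 * cos x ^+ 2 - 1) ^+ 3 / (4 * cos x ^+ 2).
Proof.
move=> c0; have r0 := lamroot_gt0 c0; have r3 := lamroot3 c0.
have -> : 4 * cos x ^+ 2 = (lamroot x ^+ 3) ^+ 2 by rewrite r3; ring.
by rewrite /lam; field; rewrite lt0r_neq0.
Qed.

Lemma L_cube : L ^+ 3 = 27 / 4 :> R.
Proof. by rewrite -lam0 lam_cube cos0//; field. Qed.

(** The argument is [cosh (ln e)], and the radicand in [arcosh] is then the square of [sinh (ln e)],
    which is nonnegative. *)
Lemma arcosh_half_sum (e : R) : 1 <= e -> arcosh ((e + e^-1) / 2) = ln e.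
Proof.
move=> e1; have e0 : e != 0 by rewrite lt0r_neq0//; lra.
have ei : e^-1 <= 1 by rewrite invf_le1//; lra.
rewrite /arcosh; have -> : ((e + e^-1) / 2) ^+ 2 - 1 = ((e - e^-1) / 2) ^+ 2.
  by field.
by rewrite sqrtr_sqr ger0_norm; [congr ln; field|lra].
Qed.

Lemma tanh_ln (e : R) : 0 < e -> tanh (ln e) = (e ^+ 2 - 1) / (e ^+ 2 + 1).
Proof.
move=> e0; rewrite /tanh expRN lnK ?posrE//; field.
by have e20 := exprn_gt0 2 e0; rewrite !lt0r_neq0//; lra.
Qed.

(* With [t = tan x / sqrt 3] and [e ^ 2 = (1 + t) / (1 - t)],
   [(L / lam x) ^ (3 / 2) = cosh (3 * ln e)] and [tanh (ln e) = t]. *)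
Lemma F_lam x : 0 < x < pi / 3 -> F (lam x) = 1 / 3 - x / pi.
Proof.
move=> xitv; have [l0 lL] := andP (lam_itv xitv); have pi0 := @pi_gt0 R.
have [x0 x1] := andP xitv.
have x01 : 0 <= x <= pi / 3 by rewrite !ltW.
have c0 := cos_gt0_third x01; have c12 : 2^-1 < cos x.
  by rewrite -cos_pithird ltr_cos ?in_itv /=; [lra|apply/andP; split; lra..].
have s30 : 0 < Num.sqrt 3 :> R by rewrite sqrtr_gt0.
have s3 : Num.sqrt 3 ^+ 2 = 3 :> R by rewrite sqr_sqrtr.
set t := tan x / Num.sqrt 3.
have tE : tan x = Num.sqrt 3 * t by rewrite /t mulrC divfK// lt0r_neq0.
have t0 : 0 <= t by rewrite divr_ge0 ?tan_ge0_third// ltW.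
have cE : cos x ^+ 2 = (1 + 3 * t ^+ 2)^-1.
  by rewrite -s3 -exprMn -tE -cos2_tan2 ?invrK// lt0r_neq0.
have t1 : t < 1.
  have : (4 : R)^-1 < cos x ^+ 2 by nra.
  rewrite cE ltf_pV2 ?posrE//; first by nra.
  by have := sqr_ge0 t; lra.
set e := Num.sqrt ((1 + t) / (1 - t)).
have w1 : 1 <= (1 + t) / (1 - t) by rewrite ler_pdivlMr; lra.
have e2 : e ^+ 2 = (1 + t) / (1 - t) by rewrite sqr_sqrtr//; lra.
have e0 : 0 <= e by exact: sqrtr_ge0.
have e1 : 1 <= e by nra.
have e3 : 1 <= e ^+ 3 by rewrite exprn_ege1.
have powE : (L / lam x) `^ (3 / 2) = (e ^+ 3 + (e ^+ 3)^-1) / 2.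
  have y0 : 0 <= (e ^+ 3 + (e ^+ 3)^-1) / 2.
    by rewrite divr_ge0// addr_ge0 ?invr_ge0; lra.
  have Ll : 0 <= L / lam x by rewrite divr_ge0; lra.
  (* The exponent [3 / 2] is read as the square root of a cube, so it suffices to compare squares,
     both rational functions of [t]. *)
  rewrite powRrM powR_mulrn// powR12_sqrt ?exprn_ge0//.
  rewrite -[RHS]ger0_norm// -sqrtr_sqr; congr Num.sqrt.
  have -> : ((e ^+ 3 + (e ^+ 3)^-1) / 2) ^+ 2
     = ((e ^+ 2) ^+ 3 + ((e ^+ 2) ^+ 3)^-1 + 2) / 4.
    by field; rewrite lt0r_neq0//; lra.
  rewrite exprMn exprVn lam_cube// L_cube e2 cE; have t20 := sqr_ge0 t.
  have t21 : t ^+ 2 < 1 by nra.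
  by field; rewrite !lt0r_neq0//; lra.
rewrite /F (gt_eqF l0) powE arcosh_half_sum// lnXn; last by lra.
have -> : 1 / 3 * (ln e *+ 3) = ln e by field.
rewrite tanh_ln; last by lra.
have -> : (e ^+ 2 - 1) / (e ^+ 2 + 1) = t.
  by rewrite e2; field; rewrite !lt0r_neq0//; lra.
rewrite -tE tanK; last by rewrite in_itv /=; apply/andP; split; lra.
by ring.
Qed.

End SymbolParametrization.

(** * Locating and ordering the eigenvalues by branches of the phase *)

Section Eigenvalues.
Variable R : realType.
Variables n : nat.
Local Notation m := (n %/ 3)%N.
Local Notation branch k := (phase n.+1 ((-1) ^+ (n + k)) : R -> R).

Lemma sign_itv (i : nat) : -1 <= ((-1) ^+ i : R) <= 1.
Proof. by rewrite -signr_odd; case: (odd i); rewrite ?expr0 ?expr1; apply/andP; split; lra. Qed.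

Lemma mul_sign_itv (s A : R) : -1 <= s <= 1 -> 0 <= A -> - A <= s * A <= A.
Proof. by move=> /andP[s0 s1] A0; apply/andP; split; nra. Qed.

Lemma sin_signM i (x : R) : sin ((-1) ^+ i * x) = (-1) ^+ i * sin x.
Proof. by rewrite -signr_odd; case: (odd i); rewrite ?expr0 ?expr1 ?mul1r ?mulN1r ?sinN. Qed.

Lemma sin_addpiX (x : R) k : sin (x + pi *+ k) = (-1) ^+ k * sin x.
Proof. exact: (alternatingn (@sinDpi R)). Qed.

Lemma natr_divn3 : n%:R = 3 * m%:R + (n %% 3)%:R :> R.
Proof. by rewrite {1}(divn_eq n 3) natrD natrM mulrC. Qed.

(** Intermediate value theorem: the branch is 0 at 0, and at [pi / 3] it is at least
    [(n + 1) * pi / 3 > pi * m], since [amp <= eta]. *)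
Lemma branch_root k : (1 <= k <= m)%N ->
  exists x : R, 0 < x < pi / 3 /\ branch k x = pi * k%:R.
Proof.
move=> /andP[k0 km]; have pi0 := @pi_gt0 R.
have k0R : 1 <= k%:R :> R by rewrite ler1n.
have kmR : k%:R <= m%:R :> R by rewrite ler_nat.
have s := sign_itv (n + k).
have p3 : 0 <= pi / 3 :> R by lra.
have h0 : branch k 0 = 0.
  have e0 : eta 0 = 0 :> R by rewrite /eta tan0 mul0r atan0.
  have p0 : 0 <= (0 : R) <= pi / 3 by rewrite lexx.
  have A0 : amp n.+1 0 = 0 :> R.
    by apply: le_anti; rewrite amp_ge0// andbT -[leRHS]e0 amp_le_eta.
  by rewrite /phase e0 A0 !mulr0 !addr0.
have h1 : pi * k%:R < branch k (pi / 3).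
  have p01 : 0 <= (pi / 3 : R) <= pi / 3 by rewrite lexx andbT.
  have A1 := amp_le_eta p01 n.+1.
  have [sA _] := andP (mul_sign_itv s (amp_ge0 p01 n.+1)).
  rewrite /phase -[n.+1%:R]natr1 natr_divn3.
  have -> : (3 * m%:R + (n %% 3)%:R + 1) * (pi / 3)
     = pi * m%:R + (pi * (n %% 3)%:R + pi) / 3 :> R by field.
  have r0 : 0 <= pi * (n %% 3)%:R :> R by rewrite mulr_ge0// ltW.
  have : pi * k%:R <= pi * m%:R :> R by rewrite ler_pM2l.
  by lra.
have [||x] := @IVT R (branch k) 0 (pi / 3) (pi * k%:R) p3.
- apply: (derivable_within_continuous (i := `[0, pi / 3]%R)) => t /= tin.
  by have [] := is_derive_phase n.+1 ((-1) ^+ (n + k)) tin.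
- rewrite h0 ge_min le_max (ltW h1) orbT andbT.
  by rewrite mulr_ge0 ?ler0n ?(ltW pi0).
rewrite in_itv /= => /andP[x0 x1] xk; exists x; split => //.
rewrite !lt_neqAle x0 x1 !andbT; apply/andP; split.
  apply/eqP => x00; move: xk; rewrite -x00 h0 => /esym/eqP.
  by rewrite gt_eqF// mulr_gt0//; lra.
by apply/eqP => xp; move: xk; rewrite xp => /eqP; rewrite gt_eqF.
Qed.

(* At [pi / 3] both [eta] and [amp] equal [pi / 6], so the branch [m + 1] stays
   below [pi * (m + 1)] on the open interval, for each residue of [n]. *)
Lemma branch_bound k (x : R) : 0 < x < pi / 3 -> branch k x = pi * k%:R ->
  (1 <= k <= m)%N.
Proof.
move=> /andP[x0 x1] xk; have pi0 := @pi_gt0 R.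
have x01 : 0 <= x <= pi / 3 by rewrite !ltW.
have A0 := amp_ge0 x01 n.+1; have A1 := amp_le_eta x01 n.+1.
have e6 := eta_le_pisixth x01; have s := sign_itv (n + k).
have nR := ler0n R n.
have nE := natr_divn3.
apply/andP; split.
  rewrite lt0n; apply/eqP => k0; move: xk; rewrite k0 mulr0 /phase -[n.+1%:R]natr1.
  rewrite k0 in s.
  have [sA _] := andP (mul_sign_itv s A0).
  have : 0 <= n%:R * x by rewrite mulr_ge0// ltW.
  by rewrite mulrDl mul1r; lra.
rewrite leqNgt; apply/negP => mk.
have p01 : 0 <= (pi / 3 : R) <= pi / 3 by apply/andP; split; lra.
have := phase_lt (ltn0Sn n) s (ltW x0) x1 (lexx _); rewrite xk /phase => lt.
have eA : amp n.+1 (pi / 3) = eta (pi / 3) :> R.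
  rewrite /amp cos_pithird mulfV// invr1 expr1n mulr1 sinK// in_itv /=.
  by rewrite !ltW ?atan_gtNpi2 ?atan_ltpi2.
have e0 := eta_ge0 p01; have {A0 A1}e6 := eta_le_pisixth p01.
have [_ sA] := andP (mul_sign_itv s e0).
move: lt; rewrite eA -[n.+1%:R]natr1 nE.
have -> : (3 * m%:R + (n %% 3)%:R + 1) * (pi / 3)
   = pi * (m%:R + ((n %% 3)%:R + 1) / 3) :> R by field.
have pi_mono (u v : R) : u <= v -> pi * u <= pi * v by rewrite ler_pM2l.
have r3 : (n %% 3 < 3)%N by rewrite ltn_pmod.
(* For [k >= m + 2] there is room to spare: [(n + 1) * pi / 3 <= pi * (k - 1)], and the two
   remaining terms add at most [pi / 3]. *)
have [k2|k1] := leqP m.+2 k.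
  have kR : m%:R + 2 <= k%:R :> R by rewrite -natrD ler_nat addn2.
  have rR : (n %% 3)%:R <= 2 :> R by rewrite ler_nat -ltnS.
  have : pi * (m%:R + ((n %% 3)%:R + 1) / 3) <= pi * (k%:R - 1) :> R.
    by apply: pi_mono; lra.
  by rewrite mulrBr mulr1; lra.
have kE : k = m.+1 by apply/eqP; rewrite eqn_leq mk andbT -ltnS.
have kR : k%:R = m%:R + 1 :> R by rewrite kE natr1.
(* For [k = m + 1] and residue 2 the sign is -1, so [eta] and [amp] cancel and the value is exactly
   [pi * (m + 1)]. For smaller residues the linear part leaves a margin of [pi / 3], which covers
   both terms. *)
have [r2|r1] := eqVneq (n %% 3)%N 2%N.
  have -> : (-1) ^+ (n + k) = -1 :> R.
    rewrite -signr_odd (_ : odd (n + k) = true)//.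
    by rewrite kE {1}(divn_eq n 3) r2 !oddD oddM andbT /=; case: odd.
  rewrite r2 kR (_ : (2 + 1) / 3 = 1); last by field.
  by lra.
have rR : (n %% 3)%:R <= 1 :> R.
  by rewrite lern1 -ltnS ltn_neqAle r1 -ltnS.
have : pi * (m%:R + ((n %% 3)%:R + 1) / 3) <= pi * (k%:R - 1 / 3) :> R.
  by apply: pi_mono; lra.
by rewrite mulrBr; lra.
Qed.

Lemma sin_eq_branch (x : R) : 0 < x < pi / 3 ->
  reflect (exists k, branch k x = pi * k%:R)
    (sin (n.+1%:R * x + eta x) + (-1) ^+ n * sin (amp n.+1 x) == 0).
Proof.
move=> /andP[x0 x1]; have pi0 := @pi_gt0 R.
have x01 : 0 <= x <= pi / 3 by rewrite !ltW.
apply: (iffP eqP) => [h|[k]]; last first.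
  rewrite /phase => h.
  have -> : n.+1%:R * x + eta x = - ((-1) ^+ (n + k) * amp n.+1 x) + pi *+ k.
    by rewrite -[pi *+ k]mulr_natr -h; ring.
  rewrite sin_addpiX sinN sin_signM mulrN mulrA -exprD addnCA addnn.
  by rewrite exprD -mul2n exprM sqrrN !expr1n mulr1 addNr.
have z0 : 0 <= n.+1%:R * x + eta x by rewrite addr_ge0 ?mulr_ge0 ?eta_ge0// ltW.
move: h; set z := n.+1%:R * x + eta x in z0 * => h.
(* Taking for [k] the integer nearest to [z / pi] puts [z - pi * k] in the range where sine is
   injective. *)
have w0 : 0 <= z / pi + 2^-1 by rewrite addr_ge0// divr_ge0// ltW.
have [k0 k1] := andP (truncn_itv w0); set k := Num.truncn _ in k0 k1.
have zk : z = (z - pi * k%:R) + pi *+ k by rewrite mulr_natr subrK.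
have [A0 A1] := (amp_ge0 x01 n.+1, amp_le_eta x01 n.+1).
have e6 := eta_le_pisixth x01.
exists k; rewrite /phase -/z.
suff -> : z = pi * k%:R - (-1) ^+ (n + k) * amp n.+1 x by rewrite subrK.
suff : z - pi * k%:R = - ((-1) ^+ (n + k) * amp n.+1 x) by move=> yE; rewrite -yE; ring.
apply: sin_inj.
- rewrite in_itv /=; move: k1; rewrite -[k.+1%:R]natr1 => k1.
  have k0' : pi * k%:R <= pi * (z / pi + 2^-1) by rewrite ler_pM2l.
  have k1' : pi * (z / pi + 2^-1) < pi * (k%:R + 1) by rewrite ltr_pM2l.
  have zE : pi * (z / pi + 2^-1) = z + pi / 2
    by rewrite mulrDr [pi * (z / pi)]mulrC divfK ?lt0r_neq0.
  by apply/andP; split; lra.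
- have [sA0 sA1] := andP (mul_sign_itv (sign_itv (n + k)) A0).
  by rewrite in_itv /=; apply/andP; split; lra.
rewrite sinN sin_signM; rewrite {1}zk sin_addpiX in h.
have s2 : (-1) ^+ k * (-1) ^+ k = 1 :> R by rewrite -expr2 sqrr_sign.
rewrite exprD; apply: (mulrI (x := (-1) ^+ k)); first by rewrite unitfE signr_eq0.
transitivity (- ((-1) ^+ n * sin (amp n.+1 x))).
  by apply/eqP; rewrite -addr_eq0; apply/eqP.
transitivity (- (((-1) ^+ k * (-1) ^+ k) * ((-1) ^+ n * sin (amp n.+1 x)))).
  by rewrite s2 mul1r.
by ring.
Qed.

Lemma eigenvalue_branch (x : R) : (0 < n)%N -> 0 < x < pi / 3 ->
  reflect (exists2 k, (1 <= k <= m)%N & branch k x = pi * k%:R)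
    (eigenvalue (toeplitz R n) (lam x)).
Proof.
move=> n0 xitv; have [x0 x1] := andP xitv; have pi0 := @pi_gt0 R.
have x01 : 0 <= x <= pi / 3 by rewrite !ltW.
have c0 := cos_gt0_third x01.
have s0 : 0 < sin x by apply: sin_gt0_pi; apply/andP; split; lra.
have -> : eigenvalue (toeplitz R n) (lam x)
    = (sin (n.+1%:R * x + eta x) + (-1) ^+ n * sin (amp n.+1 x) == 0).
  rewrite -(prednK n0) eigenvalue_charseq// prednK// charseqE// sin_amp//.
  by rewrite mulf_eq0 gt_eqF// divr_gt0 ?mulr_gt0// cos_eta_gt0.
apply: (iffP (sin_eq_branch xitv)) => [[k xk]|[k _ xk]]; last by exists k.
by exists k => //; exact: branch_bound xitv xk.
Qed.

(** Consecutive branches carry opposite signs, so [phase_lt] does not compare them. If [y <= x], the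
    two values would differ by at most [amp n.+1 x + amp n.+1 y <= pi / 3], yet they differ by
    [pi]. *)
Lemma branch_mono k (x y : R) : 0 <= x <= pi / 3 -> 0 <= y <= pi / 3 ->
  branch k x = pi * k%:R -> branch k.+1 y = pi * k.+1%:R -> x < y.
Proof.
move=> x01 y01 xk yk; have pi0 := @pi_gt0 R.
rewrite ltNge; apply/negP => yx.
have [y0 _] := andP y01; have [_ x1] := andP x01.
have [h _] := andP (eta_lipschitz y0 yx x1).
have Ax := amp_le_eta x01 n.+1; have ex := eta_le_pisixth x01.
have Ay := amp_le_eta y01 n.+1; have ey := eta_le_pisixth y01.
have [sx _] := andP (mul_sign_itv (sign_itv (n + k)) (amp_ge0 x01 n.+1)).
have [_ sy] := andP (mul_sign_itv (sign_itv (n + k.+1)) (amp_ge0 y01 n.+1)).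
have : n.+1%:R * y <= n.+1%:R * x by rewrite ler_wpM2l.
by move: xk yk; rewrite /phase -[k.+1%:R]natr1 mulrDr mulr1; lra.
Qed.

(** Both lists are strictly increasing with the same members. The index is reversed because [lam]
    decreases while the roots [th k] increase with [k]. *)
Lemma eigenvaluesE (th : nat -> R) : (0 < n)%N ->
  (forall k, (1 <= k <= m)%N ->
     0 < th k < pi / 3 /\ branch k (th k) = pi * k%:R) ->
  eigenvalues R n = [seq lam (th (m - i)%N) | i <- iota 0 m].
Proof.
move=> n0 thP; have pi0 := @pi_gt0 R.
have th01 k : (1 <= k <= m)%N -> 0 <= th k <= pi / 3.
  by move=> /thP[/andP[? ?] _]; rewrite !ltW.
have thS k : (1 <= k)%N -> (k.+1 <= m)%N -> th k < th k.+1.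
  move=> k1 km; have kk : (1 <= k <= m)%N by rewrite k1 ltnW.
  have kk' : (1 <= k.+1 <= m)%N by [].
  by apply: (@branch_mono k); rewrite ?th01//; [case: (thP _ kk)|case: (thP _ kk')].
apply: lt_sorted_eq.
- exact: sorted_eigenvalues.
- apply/(sortedP 0) => i; rewrite size_map size_iota => im.
  rewrite !(nth_map 0%N) ?size_iota ?(ltnW im)// !nth_iota ?(ltnW im)// !add0n.
  have -> : (m - i = (m - i.+1).+1)%N by lia.
  have k1 : (1 <= m - i.+1)%N by lia.
  have k2 : ((m - i.+1).+1 <= m)%N by lia.
  have /th01/andP[t0 _] : (1 <= m - i.+1 <= m)%N by lia.
  have /th01/andP[_ t1] : (1 <= (m - i.+1).+1 <= m)%N by [].
  exact: lam_lt t0 (thS _ k1 k2) t1.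
move=> l; rewrite mem_eigenvalues; apply/andP/mapP => [[el ll]|[i]].
  have [x xitv xl] := lam_surj ll; rewrite -xl in el *.
  have [k km xk] := eigenvalue_branch n0 xitv el.
  exists (m - k)%N; first by rewrite mem_iota; lia.
  rewrite subKn; last by lia.
  congr lam; have [kitv kb] := thP _ km.
  apply: (phase_inj (ltn0Sn n) (sign_itv (n + k))); rewrite ?th01 ?xk//.
  by case/andP: xitv => *; rewrite !ltW.
rewrite mem_iota add0n => /andP[_ im] ->.
have km : (1 <= m - i <= m)%N by lia.
have [xitv xk] := thP _ km; split; last exact: lam_itv.
by apply/(eigenvalue_branch n0 xitv); exists (m - i)%N.
Qed.

End Eigenvalues.

(** * The fixed-point equation and the contraction estimate *)

Section FixedPoint.
Variable R : realType.
Variables n j : nat.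
Hypothesis n_ge3 : (3 <= n)%N.
Hypothesis j_itv : (1 <= j <= n %/ 3)%N.
Implicit Types a b : R.
Local Notation m := (n %/ 3)%N.
Local Notation r := (n %% 3)%N.
Local Notation s := ((-1) ^+ (n + (m.+1 - j)) : R).
Local Notation angle a := (pi / 3 - pi * a).

Lemma angle_itv a : 0 <= a <= 1 / 3 -> 0 <= angle a <= pi / 3.
Proof.
move=> /andP[a0 a1]; have pi0 := @pi_gt0 R.
have : 0 <= pi * a by rewrite mulr_ge0// ltW.
have : pi * a <= pi * (1 / 3) by rewrite ler_pM2l.
by move=> *; apply/andP; split; lra.
Qed.

Lemma p_eta a : p a = sin (eta (angle a)).
Proof.
rewrite /p sin_etaE /eta cos_atan; move: (tan _) => T.
have -> : 9 + T ^+ 2 = 3 ^+ 2 * (1 + (T / 3) ^+ 2) by field.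
rewrite sqrtrM// sqrtr_sqr ger0_norm// invfM; ring.
Qed.

(** Parity: [n + m + 1 - j = 4 m + r + 1 - j]. *)
Lemma sign_branch : (-1) ^+ (r + j + 1) = s.
Proof.
have [j1 jm] := andP j_itv.
rewrite -signr_odd -[RHS]signr_odd; congr (_ ^+ nat_of_bool _).
rewrite {2}(divn_eq n 3) !oddD oddM oddB ?(leqW jm)//= andbT.
by case: (odd j); case: (odd r); case: (odd m).
Qed.

(** Denominator-free form behind all later estimates; [-2 / 3] collects the [-1 / 2] of [sigma] and
    the [1 / 6] of [vartheta]. *)
Lemma fE a : (n%:R + 3 / 2) * f R n j a
  = j%:R - 2 / 3 + r%:R / 3 + a / 2
    + (eta (angle a) + s * amp n.+1 (angle a)) / pi.
Proof.
have pi0 := lt0r_neq0 (@pi_gt0 R).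
rewrite /f /sigma /vartheta sign_branch p_eta /q [1 / (2 * _)]mul1r -/(eta _) -/(amp _ _).
move: pi0; move: (pi : R) (eta _) (amp _ _) => P e A pi0; field.
by rewrite pi0 lt0r_neq0//; have := ler0n R n; lra.
Qed.

Lemma f_fixedP a : 0 <= a <= 1 / 3 ->
  a = f R n j a <-> phase n.+1 s (angle a) = pi * (m.+1 - j)%:R.
Proof.
move=> a01; have [j1 jm] := andP j_itv; have pi0 := lt0r_neq0 (@pi_gt0 R).
have c0 : (n%:R + 3 / 2 : R) != 0.
  by rewrite lt0r_neq0//; have := ler0n R n; lra.
have nE := natr_divn3 R n.
have -> : phase n.+1 s (angle a)
    = pi * (n.+1%:R / 3 - n.+1%:R * a + (eta (angle a) + s * amp n.+1 (angle a)) / pi).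
  rewrite /phase; move: pi0; move: (eta _) (amp _ _) => e A pi0.
  by rewrite [RHS]mulrDr [pi * ((_ + _) / _)]mulrC divfK//; ring.
(* The term [a / 2] in [fE] turns the factor [n + 3 / 2] of [a] into the [n + 1] of the phase. *)
have bE : n.+1%:R / 3 - n.+1%:R * a + (eta (angle a) + s * amp n.+1 (angle a)) / pi
    - (m.+1 - j)%:R = (n%:R + 3 / 2) * (f R n j a - a).
  rewrite [RHS]mulrBr fE natrB ?(leqW jm)// -[n.+1%:R]natr1 -[m.+1%:R]natr1.
  have -> : r%:R = n%:R - 3 * m%:R :> R by rewrite nE addrC addKr.
  by move: (_ / pi) => t; field.
split=> [fa|/(mulfI pi0)/eqP].
  by congr (_ * _); apply/eqP; rewrite -subr_eq0 bE -fa subrr mulr0.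
by rewrite -subr_eq0 bE mulf_eq0 (negPf c0)/= subr_eq0 => /eqP.
Qed.

Lemma c_gt0 : 0 < n%:R + 3 / 2 :> R.
Proof. by have := ler0n R n; lra. Qed.

Lemma f_maps_to a : 1 / (3 * (n%:R + 1)) <= a <= 1 / 3 ->
  1 / (3 * (n%:R + 1)) <= f R n j a <= 1 / 3.
Proof.
move=> /andP[a0 a1]; have pi0 := @pi_gt0 R; have [j1 jm] := andP j_itv.
have nR := ler0n R n; have c0 := c_gt0.
have l0 : 0 <= 1 / (3 * (n%:R + 1)) :> R by rewrite divr_ge0//; lra.
have a01 : 0 <= a <= 1 / 3 by apply/andP; split; lra.
have x01 := angle_itv a01.
have A0 := amp_ge0 x01 n.+1; have A1 := amp_le_eta x01 n.+1.
have e6 := eta_le_pisixth x01.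
have [sA0 sA1] := andP (mul_sign_itv (sign_itv R (n + (m.+1 - j))) A0).
have t0 : 0 <= (eta (angle a) + s * amp n.+1 (angle a)) / pi.
  by rewrite divr_ge0//; lra.
have t1 : (eta (angle a) + s * amp n.+1 (angle a)) / pi <= 1 / 3.
  by rewrite ler_pdivrMr//; lra.
have j1R : 1 <= j%:R :> R by rewrite ler1n.
have jmR : j%:R <= m%:R :> R by rewrite ler_nat.
have rR := ler0n R r; have nE := natr_divn3 R n.
apply/andP; split; rewrite -(ler_pM2l c0) fE.
  (* The left endpoint solves [(n + 3 / 2) * a = 1 / 3 + a / 2], the extreme case of [fE] with
     [j = 1], [r = 0] and no phase contribution. *)
  have -> : (n%:R + 3 / 2) * (1 / (3 * (n%:R + 1)))
     = 1 / 3 + 1 / (3 * (n%:R + 1)) / 2 :> R.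
    by field; rewrite lt0r_neq0//; lra.
  by lra.
by lra.
Qed.

(** At a fixed point [fE] reads [(n + 1) * a = j - 2 / 3 + r / 3 + t] with [t >= 0], which is at
    least [1 / 3]. *)
Lemma fixed_ge a : 0 <= a <= 1 / 3 -> a = f R n j a ->
  1 / (3 * (n%:R + 1)) <= a.
Proof.
move=> a01 fa; have pi0 := @pi_gt0 R; have [j1 jm] := andP j_itv.
have x01 := angle_itv a01; have nR := ler0n R n; have rR := ler0n R r.
have A0 := amp_ge0 x01 n.+1; have A1 := amp_le_eta x01 n.+1.
have [sA0 _] := andP (mul_sign_itv (sign_itv R (n + (m.+1 - j))) A0).
have t0 : 0 <= (eta (angle a) + s * amp n.+1 (angle a)) / pi.
  by rewrite divr_ge0//; lra.
have j1R : 1 <= j%:R :> R by rewrite ler1n.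
have := fE a; rewrite -fa => e.
by rewrite ler_pdivrMr; lra.
Qed.

(** The linear and [eta] terms have opposite signs and together contribute at most [(b - a) / 2];
    the [amp] term contributes at most [3 / 5 * (n + 2) * (b - a)]. The sum is at most
    [4 / 5 * (n + 3 / 2) * (b - a)] once [n >= 3]. *)
Lemma f_lipschitz a b : 1 / (3 * (n%:R + 1)) <= a -> a <= b -> b <= 1 / 3 ->
  `|f R n j a - f R n j b| <= 4 / 5 * (b - a).
Proof.
move=> a0 ab b1; have pi0 := @pi_gt0 R; have c0 := c_gt0.
have nR : 3 <= n%:R :> R by rewrite ler_nat.
have l0 : 0 <= 1 / (3 * (n%:R + 1)) :> R by rewrite divr_ge0//; lra.
have a01 : 0 <= a <= 1 / 3 by apply/andP; split; lra.
have b01 : 0 <= b <= 1 / 3 by apply/andP; split; lra.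
have [xa0 xa1] := andP (angle_itv a01); have [xb0 xb1] := andP (angle_itv b01).
have xba : angle b <= angle a by rewrite lerB// ler_pM2l.
have xE : angle a - angle b = pi * (b - a) by ring.
have [e0 e1] := andP (eta_lipschitz xb0 xba xa1).
have [A0 A1] := andP (amp_lipschitz n.+1 xb0 xba xa1).
rewrite xE in e1 A1.
have u : (2 * cos (angle a))^-1 ^+ n.+1 <= 3 / 5.
  apply: invcosX_le; first exact: leqW (ltnW n_ge3).
  rewrite xa0 lerB//.
  have -> : pi / (3 * n.+1%:R) = pi * (1 / (3 * (n%:R + 1))) :> R.
    by rewrite -[n.+1%:R]natr1 mul1r.
  by rewrite ler_pM2l.
have d0 : 0 <= pi * (b - a) by rewrite mulr_ge0 ?subr_ge0// ltW.
have A2 : amp n.+1 (angle a) - amp n.+1 (angle b)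
    <= 3 / 5 * (n%:R + 2) * (pi * (b - a)).
  apply: le_trans A1 _; rewrite ler_wpM2r// -[n.+1%:R]natr1.
  have -> : n%:R + 2 = n%:R + 1 + 1 :> R by ring.
  by rewrite ler_wpM2r//; lra.
have [sA0 sA1] := andP (mul_sign_itv (sign_itv R (n + (m.+1 - j))) A0).
set E := (_ - _) in e0 e1; set A := (_ - _) in A0 A2 sA0 sA1.
have fd : (n%:R + 3 / 2) * (f R n j a - f R n j b)
    = (a - b) / 2 + (E + s * A) / pi.
  by rewrite mulrBr !fE /E /A; ring.
rewrite -(ler_pM2l c0) -[X in X * `|_|](gtr0_norm c0) -normrM fd.
have E1 : E / pi <= b - a by rewrite ler_pdivrMr// mulrC.
have E0 : 0 <= E / pi by rewrite divr_ge0// ltW.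
have S1 : s * A / pi <= 3 / 5 * (n%:R + 2) * (b - a).
  by rewrite ler_pdivrMr//; lra.
have S0 : - (3 / 5 * (n%:R + 2) * (b - a)) <= s * A / pi.
  by rewrite ler_pdivlMr//; lra.
have nd : 0 <= (n%:R - 3) * (b - a) by rewrite mulr_ge0 ?subr_ge0.
by rewrite mulrDl ler_norml; apply/andP; split; lra.
Qed.

End FixedPoint.

Theorem theorem1p3 (R : realType) (n j : nat) (hn : (3 <= n)%N)
    (hj : (1 <= j <= n %/ 3)%N) :
  contraction_on `[1 / (3 * (n%:R + 1)), 1 / 3] (f R n j) /\
  [/\ 1 / (3 * (n%:R + 1)) <= alpha R n j <= 1 / 3,
      alpha R n j = f R n j (alpha R n j) &
      forall a : R, 0 <= a <= 1 / 3 -> a = f R n j a -> a = alpha R n j].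
Proof.
have [j1 jm] := andP hj; have n0 : (0 < n)%N by lia.
have jm' : (j.-1 < n %/ 3)%N by lia.
have kE : (n %/ 3 - (0 + j.-1))%N = ((n %/ 3).+1 - j)%N by lia.
have pi0 := @pi_gt0 R; split.
  split.
    by move=> a /=; rewrite !in_itv /= => /(f_maps_to hj).
  have lip (a b : R) : 1 / (3 * (n%:R + 1)) <= a <= 1 / 3 ->
      1 / (3 * (n%:R + 1)) <= b <= 1 / 3 ->
      `|f R n j a - f R n j b| <= 4 / 5 * `|a - b|.
    move=> /andP[a0 a1] /andP[b0 b1]; have [ab|/ltW ba] := leP a b.
      by rewrite [`|a - b|]distrC [`|b - a|]ger0_norm ?subr_ge0// f_lipschitz.
    by rewrite distrC [`|a - b|]ger0_norm ?subr_ge0// f_lipschitz.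
  exists (4 / 5); split; first by apply/andP; split; lra.
  by move=> [a b] /= [/=]; rewrite !in_itv /=; exact: lip.
have /choice[th thP] k : exists x : R, (1 <= k <= n %/ 3)%N ->
    0 < x < pi / 3 /\ phase n.+1 ((-1) ^+ (n + k)) x = pi * k%:R.
  case: (boolP (1 <= k <= n %/ 3)%N) => [/(branch_root R)[x xP]|_]; last by exists 0.
  by exists x.
pose k := ((n %/ 3).+1 - j)%N.
have km : (1 <= k <= n %/ 3)%N by rewrite /k; lia.
have [xitv xk] := thP k km; have [x0 x1] := andP xitv.
have aE : alpha R n j = 1 / 3 - th k / pi.
  rewrite -(F_lam xitv); congr F.
  (* Position [j - 1] in the increasing list carries the branch index [m - (j - 1) = m + 1 - j]. *)
  by rewrite /lambda (eigenvaluesE n0 thP) (nth_map 0%N) ?size_iota ?jm' // nth_iota ?jm' // kE.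
have xE : pi / 3 - pi * alpha R n j = th k.
  rewrite aE mulrBr [pi * (th k / pi)]mulrC divfK ?lt0r_neq0//; ring.
have a01 : 0 <= alpha R n j <= 1 / 3.
  have t1 : th k / pi <= 1 / 3 by rewrite ler_pdivrMr//; lra.
  have t0 : 0 <= th k / pi by rewrite divr_ge0// ltW.
  by rewrite aE; apply/andP; split; lra.
have fa : alpha R n j = f R n j (alpha R n j).
  by apply/(f_fixedP hj a01); rewrite xE.
split=> //.
  by rewrite (fixed_ge hj a01 fa); case/andP: a01.
(* Uniqueness on all of [[0, 1 / 3]] comes from injectivity of the phase, as the contraction
   property only covers the smaller interval. *)
move=> a a01' /(f_fixedP hj a01') ak.
have := phase_inj (ltn0Sn n) (sign_itv R (n + k)) (angle_itv a01') (angle_itv a01).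
rewrite ak xE xk => /(_ erefl) e.
by apply: (mulfI (lt0r_neq0 pi0)); rewrite -xE in e; lra.
Qed.
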